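(* The space $\mathcal{D}([0,\infty))$ of real-valued càdlàg functions on $[0,\infty)$, equipped with the metric $d_\infty$, has the input-EDAP.
   Context: For a closed interval $I\subseteq\mathbb{R}$, $f:I\to\mathbb{R}$ is càdlàg if it is right-continuous and all left limits exist in $\mathbb{R}$; $\mathcal{D}(I)$ is the set of these functions. For $R\in(0,\infty)$ let $\Lambda_R$ be the set of all strictly increasing, continuous $\lambda:[0,R]\to[0,R]$ with $\lambda(0)=0$, $\lambda(R)=R$, and for $f,g\in\mathcal{D}([0,R])$ let $$d_R(f,g)=\inf_{\lambda\in\Lambda_R}\max\Big\{\sup_{t\in[0,R]}|t-\lambda(t)|,\ \sup_{t\in[0,R]}|f(t)-g(\lambda(t))|\Big\}.$$ Define $\psi_R:\mathcal{D}([0,\infty))\to\mathcal{D}([0,R])$ by $\psi_Rf(t)=f(t)$ if $t\le R-1$ and $\psi_Rf(t)=f(t)(R-t)$ if $R-1<t\le R$. The metric $d_\infty$ on $\mathcal{D}([0,\infty))$ is $$d_\infty(f,g)=\sum_{R=1}^\infty 2^{-R}\min\big\{1,\ d_R(\psi_R(f),\psi_R(g))\big\}.$$ Input-EDAP (for $\mathbb{K}\in\{\mathbb{R},\mathbb{C}\}$): a metric space $(\mathcal{X},\rho)$ has the input-EDAP if there are mappings $E_n:\mathcal{X}\to\mathbb{K}^{w(n)}$ (possibly discontinuous, $w(n)\in\mathbb{N}$) and $D_n:\overline{E_n(\mathcal{X})}\to\mathcal{X}$, $n\in\mathbb{N}$, such that: (i) there is $r:\mathbb{N}\to(0,\infty)$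 such that for each compact $K\subseteq\mathcal{X}$ there is $N_K\in\mathbb{N}$ with $\sup_{f\in K}|E_n(f)|\le r(n)$ for all $n\ge N_K$; (ii) each $D_n$ is continuous; (iii) for every compact $K\subseteq\mathcal{X}$, $\sup_{f\in K}\rho(f,D_n(E_n(f)))\to0$ as $n\to\infty$. *)

(* Defs.v *)
From HB Require Import structures.
From mathcomp Require Import all_boot all_order all_algebra.
From mathcomp Require Import all_classical all_reals all_analysis.
From mathcomp Require Import lra.

Set Implicit Arguments.
Unset Strict Implicit.
Unset Printing Implicit Defensive.

Import Order.TTheory GRing.Theory Num.Theory.
Import numFieldNormedType.Exports.

Local Open Scope classical_set_scope.
Local Open Scope ring_scope.

(* At a right (resp. left) endpoint [t] of [I], the filter [within I t^'+]
   (resp. [within I t^'-]) contains the empty set, so that the corresponding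
   condition is void there. *)
Definition cadlag (R : realType) (I : set R) (f : R -> R) : Prop :=
  forall t, I t ->
    f x @[x --> within I t^'+] --> f t /\
    exists l : R, f x @[x --> within I t^'-] --> l.

(* A function [I -> R] is represented by its extension by 0 to [R], so that
   Leibniz equality on [cadlag_fun I] is pointwise equality on [I]. *)
Record cadlag_fun (R : realType) (I : set R) := CadlagFun {
  cadlag_val :> R -> R ;
  cadlag_valP : cadlag I cadlag_val ;
  cadlag_val_out : forall t, ~ I t -> cadlag_val t = 0 }.

HB.instance Definition _ (R : realType) (I : set R) :=
  gen_eqMixin (cadlag_fun I).
HB.instance Definition _ (R : realType) (I : set R) :=
  gen_choiceMixin (cadlag_fun I).

Lemma cadlag_funP (R : realType) (I : set R) (f g : cadlag_fun I) :
  (forall t, I t -> f t = g t) -> f = g.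
Proof.
case: f g => [f fc f0] [g gc g0] /= fg.
have E : f = g.
  apply/funext => t; have [It|It] := pselect (I t); first exact: fg.
  by rewrite f0 // g0.
by move: fc f0; rewrite {fg} E => fc f0; congr CadlagFun; exact: Prop_irrelevance.
Qed.

Definition time_change (R : realType) (T : R) : set (R -> R) :=
  [set l : R -> R | [/\ {homo l : t / t \in `[0, T]},
               {in `[0, T] &, {homo l : s t / s < t}},
               {within `[0, T], continuous l},
               l 0 = 0 & l T = T]].

(* The infima and suprema are taken in [\bar R]; since càdlàg functions on
   [0, T] are bounded, all of them are finite when [0 < T]. *)
Definition skorokhod_dist (R : realType) (T : R) (f g : cadlag_fun `[0, T])
    : \bar R :=
  ereal_inf [set maxe (ereal_sup [set `|t - l t|%:E | t in `[0, T]])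
                      (ereal_sup [set `|f t - g (l t)|%:E | t in `[0, T]])
            | l in time_change T].

Section Psi.
Variables (R : realType) (T : R) (f : cadlag_fun (`[0, +oo[ : set R)).

(* For [t < 0] this is 0 because [f] vanishes there. *)
Definition psi_val (t : R) : R :=
  if t <= T - 1 then f t else if t <= T then f t * (T - t) else 0.

Let clamp (t : R) : R := Num.max 0 (Num.min 1 (T - t)).

Let psi_valE : psi_val = fun t => f t * clamp t.
Proof.
apply/funext => t; rewrite /psi_val /clamp.
case: ifPn => [h|].
  by rewrite min_l ?max_r ?mulr1 // lerBrDr addrC -lerBrDr.
rewrite -ltNge => h; rewrite [Num.min _ _]min_r; last first.
  by rewrite lerBlDr addrC -lerBlDr ltW.
case: ifPn => [h'|]; first by rewrite max_r // subr_ge0.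
by rewrite -ltNge => h'; rewrite max_l ?mulr0 // subr_le0 ltW.
Qed.

Let clamp_continuous : continuous clamp.
Proof.
move=> t; apply: (@continuous_max R R (cst 0) (fun s => Num.min 1 (T - s))).
  exact: cvg_cst.
apply: (@continuous_min R R (cst 1) (fun s => T - s)); first exact: cvg_cst.
by apply: cvgB; [exact: cvg_cst|exact: cvg_id].
Qed.

Lemma psi_cadlag : cadlag `[0, T] psi_val.
Proof.
have sub : `[0, T] `<=` (`[0, +oo[ : set R).
  by move=> s /=; rewrite !in_itv /= => /andP[->].
move=> t /sub /(cadlag_valP f) [fr [l fl]]; rewrite psi_valE.
have ct : clamp x @[x --> t] --> clamp t := @clamp_continuous t.
split.
  apply: cvgM.
    by apply: cvg_trans fr; apply: cvg_app; exact: within_subset.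
  apply: cvg_trans ct; apply: cvg_app.
  exact: cvg_trans (cvg_within _) (cvg_within _).
exists (l * clamp t); apply: cvgM.
  by apply: cvg_trans fl; apply: cvg_app; exact: within_subset.
apply: cvg_trans ct; apply: cvg_app.
exact: cvg_trans (cvg_within _) (cvg_within _).
Qed.

Lemma psi_out t : ~ [set` `[0, T]] t -> psi_val t = 0.
Proof.
rewrite /= in_itv /= => /negP; rewrite negb_and -!ltNge => /orP[t0|tT].
  rewrite /psi_val (cadlag_val_out f) ?mul0r ?if_same //.
  by rewrite /= in_itv /= leNgt t0.
rewrite /psi_val ifF; last first.
  by apply/negbTE; rewrite -ltNge (le_lt_trans _ tT) // gerBl.
by rewrite ifF //; apply/negbTE; rewrite -ltNge.
Qed.

Definition psi : cadlag_fun (`[0, T] : set R) := CadlagFun psi_cadlag psi_out.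

End Psi.

Definition skorokhod (R : realType) : Type := cadlag_fun (`[0, +oo[ : set R).

(* The series is at most 1, so that [fine] only changes the type: see
   [skorokhod_mdistE]. *)
HB.lock Definition skorokhod_mdist (R : realType) (f g : skorokhod R) : R :=
  fine (\sum_(1 <= N <oo)
    ((2 ^- N)%:E * mine 1 (skorokhod_dist (psi N%:R f) (psi N%:R g))))%E.

Section SkorokhodDist.
Variables (R : realType) (T : R).
Hypothesis T0 : 0 <= T.
Implicit Types (f g h : cadlag_fun (`[0, T] : set R)) (l m : R -> R).

Let cost l f g : \bar R :=
  maxe (ereal_sup [set `|t - l t|%:E | t in `[0, T]])
       (ereal_sup [set `|f t - g (l t)|%:E | t in `[0, T]]).

Let I0 : 0 \in `[0, T]. Proof. by rewrite in_itv /= lexx T0. Qed.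
Let IT : T \in `[0, T]. Proof. by rewrite in_itv /= lexx T0. Qed.

Let cost_time l f g t : t \in `[0, T] -> (`|t - l t|%:E <= cost l f g)%E.
Proof.
by move=> tT; rewrite /cost le_max; apply/orP; left; apply: ereal_sup_ubound;
  exists t.
Qed.

Let cost_val l f g t : t \in `[0, T] -> (`|f t - g (l t)|%:E <= cost l f g)%E.
Proof.
by move=> tT; rewrite /cost le_max; apply/orP; right; apply: ereal_sup_ubound;
  exists t.
Qed.

Let cost_le l f g (x : \bar R) :
  (forall t, t \in `[0, T] -> (`|t - l t|%:E <= x)%E) ->
  (forall t, t \in `[0, T] -> (`|f t - g (l t)|%:E <= x)%E) ->
  (cost l f g <= x)%E.
Proof.
move=> h1 h2; rewrite /cost ge_max; apply/andP; split;
  apply: ge_ereal_sup => _ [t tT <-]; first [exact: h1|exact: h2].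
Qed.

Let cost_ge0 l f g : (0 <= cost l f g)%E.
Proof. by apply: le_trans (cost_time l f g I0); rewrite lee_fin. Qed.

Let dist_le l f g : time_change T l -> (skorokhod_dist f g <= cost l f g)%E.
Proof. by move=> Tl; apply: ereal_inf_lbound; exists l. Qed.

Lemma skorokhod_dist_ge0 f g : (0 <= skorokhod_dist f g)%E.
Proof. by apply: le_ereal_inf_tmp => _ [l _ <-]; exact: cost_ge0. Qed.

Let time_change_mono l : time_change T l ->
  {in `[0, T] &, {mono l : s t / s <= t}}.
Proof. by case=> _ linc _ _ _; exact: le_mono_in. Qed.

Let time_change_surj l : time_change T l -> set_surj `[0, T] `[0, T] l.
Proof.
case=> _ _ lc l0 lT; have := @segment_continuous_le_surjective R 0 T l.
by by rewrite l0 lT; apply.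
Qed.

Let time_change_build l :
  {homo l : t / t \in `[0, T]} -> {in `[0, T] &, {homo l : s t / s < t}} ->
  set_surj `[0, T] `[0, T] l -> l 0 = 0 -> l T = T -> time_change T l.
Proof.
move=> lT linc ls l0 lT'; split => //.
apply: segment_inc_surj_continuous; first exact: le_mono_in.
by rewrite l0 lT'.
Qed.

Let time_change_id : time_change T id.
Proof. by apply: time_change_build => // t tT; exists t. Qed.

Let time_change_comp l m :
  time_change T l -> time_change T m -> time_change T (m \o l).
Proof.
move=> Tl Tm; have ls := time_change_surj Tl; have ms := time_change_surj Tm.
case: Tl Tm => lI linc _ l0 lT [mI minc _ m0 mT].
apply: time_change_build => /=; rewrite ?l0 ?lT //.
- by move=> t /lI /mI.
- by move=> s t sT tT st; apply: minc; [exact: lI|exact: lI|exact: linc].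
- by move=> t /ms [s /ls [u uT <-] <-]; exists u.
Qed.

Let time_change_inv l : time_change T l ->
  exists2 m, time_change T m & {in `[0, T], cancel m l}.
Proof.
move=> Tl; have lm := time_change_mono Tl.
have ls := time_change_surj Tl.
have lmlt := leW_mono_in lm; have linj := inc_inj_in lm.
case: Tl => lI linc _ l0 lT.
have /choice [m mP] : forall t, exists s,
    t \in `[0, T] -> s \in `[0, T] /\ l s = t.
  move=> t; have [tT|tT] := pselect (t \in `[0, T]); last by exists 0.
  by have [s sT <-] := ls t tT; exists s.
exists m; last by move=> t /mP [].
have mI t : t \in `[0, T] -> m t \in `[0, T] by move=> /mP [].
have mK t : t \in `[0, T] -> l (m t) = t by move=> /mP [].
have lK t : t \in `[0, T] -> m (l t) = t.
  by move=> tT; apply: linj; rewrite ?mI ?mK ?lI.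
apply: time_change_build => //.
- by move=> s t sT tT st; rewrite -lmlt ?mI // !mK.
- by move=> t tT; exists (l t); [exact: lI|exact: lK].
- by rewrite -{1}l0 lK.
- by rewrite -{1}lT lK.
Qed.

Lemma skorokhod_distxx f : skorokhod_dist f f = 0%E.
Proof.
apply/eqP; rewrite eq_le skorokhod_dist_ge0 andbT.
apply: le_trans (dist_le f f time_change_id) _.
by apply: cost_le => t _; rewrite subrr normr0.
Qed.

Let skorokhod_dist_sym_le f g : (skorokhod_dist f g <= skorokhod_dist g f)%E.
Proof.
apply: le_ereal_inf_tmp => _ [l Tl <-]; have [m Tm mK] := time_change_inv Tl.
apply: le_trans (dist_le f g Tm) _; case: Tm => mI _ _ _ _.
apply: cost_le => t tT.
  have := cost_time l g f (mI _ tT); rewrite mK // distrC.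
  by [].
by have := cost_val l g f (mI _ tT); rewrite mK // distrC.
Qed.

Lemma skorokhod_dist_sym f g : skorokhod_dist f g = skorokhod_dist g f.
Proof. by apply/eqP; rewrite eq_le !skorokhod_dist_sym_le. Qed.

Lemma skorokhod_dist_triangle g f h :
  (skorokhod_dist f h <= skorokhod_dist f g + skorokhod_dist g h)%E.
Proof.
have H l m : time_change T l -> time_change T m ->
    (skorokhod_dist f h <= cost l f g + cost m g h)%E.
  move=> Tl Tm; apply: le_trans (dist_le f h (time_change_comp Tl Tm)) _.
  have lI : {homo l : t / t \in `[0, T]} by case: Tl.
  apply: cost_le => t tT /=.
    apply: le_trans (leeD (cost_time l f g tT) (cost_time m g h (lI _ tT))).
    by rewrite -EFinD lee_fin ler_distD.
  apply: le_trans (leeD (cost_val l f g tT) (cost_val m g h (lI _ tT))).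
  by rewrite -EFinD lee_fin ler_distD.
have [->|fgy] := eqVneq (skorokhod_dist f g) +oo%E.
  by rewrite addye ?leey // gt_eqF // (lt_le_trans _ (skorokhod_dist_ge0 _ _)).
have fgfin : skorokhod_dist f g \is a fin_num.
  by rewrite ge0_fin_numE ?skorokhod_dist_ge0 // ltey.
rewrite -leeBlDl //; apply: le_ereal_inf_tmp => _ [m Tm <-].
rewrite leeBlDl //.
have [E|my] := eqVneq (cost m g h) +oo%E.
  by rewrite -/(cost m g h) E addey ?leey // gt_eqF // (lt_le_trans _ (skorokhod_dist_ge0 _ _)).
have mfin : cost m g h \is a fin_num by rewrite ge0_fin_numE // ltey.
rewrite -leeBlDr //; apply: le_ereal_inf_tmp => _ [l Tl <-].
by rewrite leeBlDr //; exact: H.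
Qed.

Lemma skorokhod_dist_eq0 f g : skorokhod_dist f g = 0%E -> f = g.
Proof.
move=> fg0.
have small (e : R) : 0 < e -> exists l, [/\ time_change T l,
    forall t, t \in `[0, T] -> `|t - l t| < e &
    forall t, t \in `[0, T] -> `|f t - g (l t)| < e].
  move=> e0.
  have [_ [l Tl <-] le] : exists2 x, [set cost l f g | l in time_change T] x & (x < e%:E)%E.
    by apply: ereal_inf_lt; rewrite [ereal_inf _]fg0 lte_fin.
  exists l; split => // t tT; rewrite -lte_fin.
    exact: le_lt_trans (cost_time l f g tT) le.
  exact: le_lt_trans (cost_val l f g tT) le.
apply: cadlag_funP => t tT.
apply/eqP; rewrite -subr_eq0 -normr_eq0 eq_le normr_ge0 andbT.
apply/ler_addgt0Pl => /= e e0; rewrite addr0.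
have [tltT|] := ltP t T; last first.
  move=> Tt; have {Tt tT} -> : t = T.
    by apply/eqP; rewrite eq_le Tt andbT; move: tT; rewrite /= in_itv /= => /andP[].
  have [l [[_ _ _ _ lT] _ /(_ T IT)]] := small e e0.
  by rewrite lT => /ltW.
have t0 : 0 <= t by move: tT; rewrite /= in_itv /= => /andP[].
have right (u : cadlag_fun (`[0, T] : set R)) : exists2 d : R, 0 < d &
    forall s, s \in `[0, T] -> t <= s < t + d -> `|u t - u s| < e / 3.
  have [/cvgrPdist_lt ur _] := cadlag_valP u tT.
  have e3 : 0 < e / 3 by rewrite divr_gt0.
  have := ur _ e3; rewrite !near_withinE => /nbhs_ballP [d /= d0 H].
  exists d => // s sT /andP[]; rewrite le_eqVlt => /orP[/eqP <- _|ts std].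
    by rewrite subrr normr0.
  by apply: H => //; rewrite /ball /= distrC gtr0_norm ?subr_gt0 // ltrBlDl.
have [d1 d10 H1] := right f; have [d2 d20 H2] := right g.
pose d := Num.min (T - t) (Num.min d1 d2).
have d0 : 0 < d by rewrite !lt_min subr_gt0 tltT d10 d20.
have dT : d <= T - t by rewrite ge_min lexx.
have dd1 : d <= d1 by rewrite !ge_min lexx orbT.
have dd2 : d <= d2 by rewrite !ge_min lexx !orbT.
pose s := t + d / 2.
have sT : s \in `[0, T] by rewrite in_itv /= /s; lra.
have m0 : 0 < Num.min (d / 2) (e / 3) by rewrite lt_min !divr_gt0.
have [l [Tl lt lv]] := small _ m0.
have lsT : l s \in `[0, T] by case: Tl => + _ _ _ _; exact.
have := lt _ sT; have := lv _ sT; rewrite !lt_min => /andP[_ h1] /andP[h2 _].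
have h3 : `|f t - f s| < e / 3 by apply: H1 => //; rewrite /s; lra.
have h4 : `|g t - g (l s)| < e / 3.
  by apply: H2 => //; move: h2; rewrite ltr_norml /s; lra.
have : `|f t - g t| <= `|f t - f s| + `|f s - g (l s)| + `|g t - g (l s)|.
  rewrite (distrC (g t)); apply: le_trans (ler_distD (g (l s)) _ _) _.
  by rewrite lerD2r; exact: ler_distD.
by move=> h5; lra.
Qed.

End SkorokhodDist.

Section SkorokhodMetric.
Variable R : realType.
Implicit Types f g h : skorokhod R.
Local Open Scope ereal_scope.

Let term f g (N : nat) : \bar R :=
  (2 ^- N)%:E * mine 1 (skorokhod_dist (psi N%:R f) (psi N%:R g)).

Let w_ge0 N : 0 <= (2 ^- N : R)%:E.
Proof. by rewrite lee_fin invr_ge0 exprn_ge0. Qed.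

Let min_ge0 f g N :
  0 <= mine 1 (skorokhod_dist (psi N%:R f) (psi N%:R g)).
Proof. by rewrite le_min lee01 skorokhod_dist_ge0. Qed.

Let term_ge0 f g N : 0 <= term f g N.
Proof. by rewrite mule_ge0 // min_ge0. Qed.

Let series_ge0 f g : 0 <= \sum_(1 <= N <oo) term f g N.
Proof. by apply: nneseries_ge0 => N _ _; exact: term_ge0. Qed.

Let series_le1 f g : \sum_(1 <= N <oo) term f g N <= 1.
Proof.
have half : \sum_(1 <= N <oo) (2 ^- N : R)%:E = 1.
  rewrite -(@nneseries_addn _ (fun N => (2 ^- N : R)%:E)) //.
  have := @cvg_geometric_eseries_half R 1%R 0; rewrite expr0 divr1.
  move=> /cvg_lim <- //; apply: eq_eseriesr => i _.
  by rewrite addn1 natrX div1r.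
rewrite -half; apply: lee_nneseries => [N _ _|N _]; first exact: term_ge0.
by rewrite -[leRHS]mule1 /term lee_wpmul2l // ge_min lexx.
Qed.

Lemma skorokhod_mdistE f g : (skorokhod_mdist f g)%:E =
  \sum_(1 <= N <oo)
    ((2 ^- N)%:E * mine 1 (skorokhod_dist (psi N%:R f) (psi N%:R g))).
Proof.
rewrite skorokhod_mdist.unlock fineK // ge0_fin_numE; last exact: series_ge0.
exact: le_lt_trans (series_le1 f g) (ltry 1).
Qed.

Let mdistE f g : (skorokhod_mdist f g)%:E = \sum_(1 <= N <oo) term f g N.
Proof. exact: skorokhod_mdistE. Qed.

Lemma skorokhod_mdistxx f : skorokhod_mdist f f = 0%R.
Proof.
apply: EFin_inj; rewrite mdistE; apply: eseries0 => N _ _.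
by rewrite /term skorokhod_distxx // min_r ?mule0.
Qed.

Lemma skorokhod_mdist_sym f g : skorokhod_mdist f g = skorokhod_mdist g f.
Proof.
apply: EFin_inj; rewrite !mdistE; apply: eq_eseriesr => N _.
by rewrite /term skorokhod_dist_sym.
Qed.

Lemma skorokhod_mdist_triangle g f h :
  (skorokhod_mdist f h <= skorokhod_mdist f g + skorokhod_mdist g h)%R.
Proof.
rewrite -lee_fin EFinD !mdistE -nneseriesD; try by move=> *; exact: term_ge0.
apply: lee_nneseries => [N _ _|N _]; first exact: term_ge0.
rewrite /term -ge0_muleDr ?min_ge0 // lee_wpmul2l //.
have N0R : (0 <= N%:R :> R)%R by exact: ler0n.
have := skorokhod_dist_triangle N0R (psi N%:R g) (psi N%:R f) (psi N%:R h).
have := skorokhod_dist_ge0 N0R (psi N%:R f) (psi N%:R g).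
have := skorokhod_dist_ge0 N0R (psi N%:R g) (psi N%:R h).
move: (skorokhod_dist (psi N%:R f) (psi N%:R h)) => c.
move: (skorokhod_dist (psi N%:R f) (psi N%:R g)) => a.
move: (skorokhod_dist (psi N%:R g) (psi N%:R h)) => b b0 a0 cab.
have [a1|a1] := leP 1 a.
  rewrite (@le_trans _ _ 1) ?ge_min ?lexx // leeDl //.
  by rewrite le_min lee01.
have [b1|b1] := leP 1 b.
  by rewrite (@le_trans _ _ 1) ?ge_min ?lexx // leeDr.
by rewrite ge_min cab orbT.
Qed.

Lemma skorokhod_mdist_positivity f g : skorokhod_mdist f g = 0%R -> f = g.
Proof.
move=> fg0; have : \sum_(1 <= N <oo) term f g N = 0 by rewrite -mdistE fg0.
move=> s0; apply: cadlag_funP => t; rewrite /= in_itv /= andbT => t0.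
pose N := (Num.truncn t).+2.
have N0R : (0 <= N%:R :> R)%R by exact: ler0n.
have tN : (t <= N%:R - 1)%R.
  by rewrite /N -addn1 natrD addrK ltW // truncnS_gt.
have T0 : term f g N = 0.
  apply/eqP; rewrite eq_le term_ge0 // andbT -s0.
  apply: le_trans (nneseries_lim_ge N.+1 _); last by move=> *; exact: term_ge0.
  by rewrite big_nat_recr //= leeDr // sume_ge0.
have d0 : skorokhod_dist (psi N%:R f) (psi N%:R g) = 0.
  move: T0 => /eqP; rewrite mule_eq0 eqe invr_eq0 expf_eq0 /= pnatr_eq0 /=.
  by rewrite /mine; case: ifP => _ /eqP // /eqP; rewrite onee_eq0.
have /(congr1 (fun u : cadlag_fun _ => u t)) := skorokhod_dist_eq0 N0R d0.
by rewrite /= /psi_val tN.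
Qed.

End SkorokhodMetric.

HB.instance Definition _ (R : realType) := Choice.on (skorokhod R).
HB.instance Definition _ (R : realType) :=
  isMetric.Build R (skorokhod R) (@skorokhod_mdistxx R)
    (@skorokhod_mdist_positivity R) (@skorokhod_mdist_sym R)
    (fun g f h => @skorokhod_mdist_triangle R g f h).

(* [K] stands for the reals or the complex numbers ([R] or [R[i]]). In either
   case [0 < r n] says that [r n] is a positive real number. The norm on
   ['rV[K]_(w n)] is the maximum norm; since [r] may depend on [n], the
   notion does not depend on this choice. [ereal_sup set0] is [-oo], not 0,
   hence the restriction to nonempty [C] in the last clause, which is void for
   the empty set. *)
Definition input_EDAP (R : realType) (K : numFieldType) (X : metricType R)
    : Prop :=
  exists (w : nat -> nat) (E : forall n, X -> 'rV[K]_(w n))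
         (D : forall n, 'rV[K]_(w n) -> X),
    [/\ forall n, (0 < w n)%N,
        exists2 r : nat -> K, forall n, 0 < r n &
          forall C : set X, compact C ->
            exists N, forall n, (N <= n)%N -> forall f, C f -> `|E n f| <= r n,
        forall n, {within closure (range (E n)), continuous (D n)} &
        forall C : set X, compact C -> C !=set0 ->
          ereal_sup [set (mdist f (D n (E n f)))%:E | f in C]
            @[n --> \oo] --> 0%E].

(* Main.v *)
(** Every separable metric space [X] has the input-EDAP: with [x] a dense
    sequence, [E_n f] is the index of a point of [x 0, ..., x n] nearest to [f]
    and [D_n] maps an index [i] to [x i]. The range of [E_n] is finite, so that
    [D_n] is continuous on it, and [min_(i <= n) rho (f, x i)] tends to 0
    uniformly on compact sets.

    It remains to see that the Skorokhod space is separable. A càdlàg function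
    restricted to [k, k+1] has, up to a given precision, a finite code: the
    breakpoints and the values of a step function, rounded to rationals. If two
    functions have the same codes on [0, 1], ..., [N-1, N], then the piecewise
    affine map sending the breakpoints of one to those of the other is a time
    change of [0, M] under which they are close, simultaneously for all
    [M <= N], because the integers are fixed. Hence for every [e > 0] there is a
    countable partition of the space into sets of diameter at most [e]. *)

Require Import Defs.
From mathcomp Require Import all_boot all_order all_algebra.
From mathcomp Require Import all_classical all_reals all_analysis.
From mathcomp Require Import complex lra ring.

Set Implicit Arguments.
Unset Strict Implicit.
Unset Printing Implicit Defensive.

Import Order.TTheory GRing.Theory Num.Theory.
Import numFieldNormedType.Exports.

Local Open Scope classical_set_scope.
Local Open Scope ring_scope.

(** * Separable metric spaces: encoding by the index of a nearest point *)

Section SeparableInputEDAP.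
Variables (R : realType) (K : numFieldType) (X : metricType R) (x : nat -> X).
Hypothesis x_dense : forall (f : X) (e : R), 0 < e -> exists k, mdist f (x k) < e.

Let nearest n (f : X) : 'I_n.+1 := [arg min_(i < ord0) mdist f (x i)]%O.

Let nearestP n f (k : nat) : (k <= n)%N ->
  mdist f (x (nearest n f)) <= mdist f (x k).
Proof.
move=> kn; rewrite /nearest; case: Order.TotalTheory.arg_minP => // i _ H.
exact: (H (Ordinal (kn : (k < n.+1)%N))).
Qed.

Let enc n (f : X) : 'rV[K]_1 := const_mx (nearest n f)%:R.
(** The value [x 0] is a default for vectors that are not an index at most [n], all of them outside
    the closure of the range of [enc n]. *)
Let dec n (v : 'rV[K]_1) : X :=
  if [pick i : 'I_n.+1 | v == const_mx i%:R] is Some i then x i else x 0%N.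

Let norm_rV1 (v : 'rV[K]_1) : `|v| = `|v 0 0|.
Proof.
change (mx_norm v = `|v 0 0|); have [v0|/mx_norm_neq0[[i j]]] := eqVneq (mx_norm v) 0.
  by rewrite v0 (mx_norm_eq0 v0) mxE normr0.
by rewrite !ord1.
Qed.

(** Distinct naturals are at distance at least 1. This makes indices decodable and the set of codes
    discrete. *)
Let const_natr_dist (i j : nat) :
  `|const_mx i%:R - const_mx j%:R : 'rV[K]_1| < 1 -> i = j.
Proof.
wlog ij : i j / (i <= j)%N => [H|].
  have [/H //|/ltnW/H + h] := leqP i j.
  by move=> -> //; rewrite distrC.
rewrite distrC norm_rV1 !mxE -natrB // normr_nat -[1]/(1%:R) ltr_nat ltnS.
by rewrite leqn0 subn_eq0 => ji; apply/eqP; rewrite eqn_leq ij.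
Qed.

Lemma separable_input_EDAP : input_EDAP K X.
Proof.
have decK n f : dec n (enc n f) = x (nearest n f).
  rewrite /dec /enc; case: pickP => [i /eqP E|/(_ (nearest n f))]; last by rewrite eqxx.
  by rewrite (@const_natr_dist (nearest n f) i) // E subrr normr0.
exists (fun=> 1%N), enc, dec; split => //.
- exists (fun n => n.+1%:R) => [n|C _]; first by rewrite ltr0n.
  by exists 0%N => n _ f _; rewrite norm_rV1 mxE normr_nat ler_nat ltnW.
- move=> n.
  pose A := [set (const_mx (i : 'I_n.+1)%:R : 'rV[K]_1) | i in setT].
  (* The finite set [A] is closed, so taking the closure of the range adds nothing outside [A]. *)
  have cA : closure (range (enc n)) `<=` A.
    have clA : closed A.
      apply: (accessible_finite_set_closed.1 _ A).
        exact/hausdorff_accessible/norm_hausdorff.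
      exact/finite_image/finite_finset.
    rewrite [X in _ `<=` X](closure_id A).1 //.
    by apply: closureS => _ [f _ <-]; exists (nearest n f).
  apply: (continuous_subspaceW cA); apply/subspace_continuousP => v Av U UDv.
  (* The unit ball around [v] meets [A] only in [v], so any map is continuous there relative to
     [A]. *)
  have : nbhs v (ball v 1) by exact: nbhsx_ballx.
  apply: filterS => u uv Au; case: Av Au uv => i _ iv [j _ ju].
  rewrite mx_norm_ball /ball_ /= -iv -ju => /const_natr_dist ij.
  by rewrite -ij iv; exact: nbhs_singleton.
move=> C cC [f0 Cf0]; apply/fine_cvgP.
have near_le e : 0 < e -> \forall n \near \oo,
    (0 <= ereal_sup [set (mdist f (dec n (enc n f)))%:E | f in C] <= e%:E)%E.
  move=> e0.
  (* Compactness as near-covering: if [x k] is within [e / 2] of [f], it is within [e] of every [g]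
     in the ball of radius [e / 2], and is available once [k <= n]. *)
  have : \forall n \near \oo, C `<=` (fun f => mdist f (x (nearest n f)) <= e).
    apply: (compact_near_coveringP C).1 => // f Cf.
    have [k fk] := x_dense f (divr_gt0 e0 (ltr0n _ 2)).
    exists (ball f (e / 2), [set n | (k <= n)%N]) => /=.
      split; first by apply: nbhsx_ballx; rewrite divr_gt0.
      by exists k.
    move=> [g n] /= [+ kn]; rewrite ballEmdist /= metric_sym => fg.
    apply: le_trans (nearestP _ kn) _; apply: le_trans (metric_triangle g f (x k)) _.
    by rewrite [leRHS]splitr ltW // ltrD.
  apply: filterS => n Cn; apply/andP; split.
    apply: le_trans _ (ereal_sup_ubound _); last by exists f0.
    by rewrite lee_fin mdist_ge0.
  by apply: ge_ereal_sup => _ [f Cf <-]; rewrite lee_fin decK; exact: Cn.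
split.
  apply: filterS (near_le 1 ltr01) => n /andP[h0 h1].
  by rewrite ge0_fin_numE // (le_lt_trans h1) // ltry.
apply/cvgrPdist_le => e e0; apply: filterS (near_le e e0) => n /andP[h0 h1].
rewrite sub0r normrN /= ger0_norm ?fine_ge0 // -lee_fin fineK //.
by rewrite ge0_fin_numE // (le_lt_trans h1) // ltry.
Qed.

End SeparableInputEDAP.

(** * Time changes between segments, and rational codes of càdlàg functions *)

Section Matching.
Variable R : realType.
Implicit Types (f g l : R -> R) (a b e d : R).

(** Surjectivity stands for continuity, to which it is equivalent for such increasing maps. Values
    are compared on [[a, b[] only, so that consecutive pieces share no breakpoint and a one-point
    segment carries no value condition. *)
Definition matching e d f g a b a' b' := exists l,
  [/\ {in `[a, b] &, {homo l : s t / s < t}},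
      set_surj `[a, b] `[a', b'] l,
      l a = a' /\ l b = b',
      forall t, a <= t <= b -> `|t - l t| <= d &
      forall t, a <= t < b -> `|f t - g (l t)| <= e].

Lemma matching_point e d f g a a' :
  `|a - a'| <= d -> matching e d f g a a a' a'.
Proof.
move=> aa'; exists (fun t => t + (a' - a)); split.
- by move=> s t _ _; rewrite ltrD2r.
- move=> u /=; rewrite in_itv /= -eq_le => /eqP <-.
  by exists a; rewrite ?subrKC // /= in_itv /= lexx.
- by rewrite subrKC.
- by move=> t; rewrite -eq_le => /eqP <-; rewrite subrKC.
- by move=> t /andP[h1 /(le_lt_trans h1)]; rewrite ltxx.
Qed.

Lemma matching_glue e d f g a b c a' b' c' : a <= b -> b <= c ->
  matching e d f g a b a' b' -> matching e d f g b c b' c' ->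
  matching e d f g a c a' c'.
Proof.
move=> ab bc [l [linc ls [la lb] lt lv]] [m [minc ms [mb mc] mt mv]].
exists (fun t => if t < b then l t else m t); split.
- move=> s t; rewrite !in_itv /= => /andP[s1 s2] /andP[t1 t2] st.
  have [sb|bs] := ltP s b; have [tb|bt] := ltP t b.
  + by apply: linc => //; rewrite in_itv /= ?s1 ?t1 ltW.
  + apply: (@lt_le_trans _ _ b').
      by rewrite -lb; apply: linc => //; rewrite in_itv /= ?ab ?lexx // s1 ltW.
    rewrite -mb; move: bt; rewrite le_eqVlt => /orP[/eqP <- //|bt].
    by apply/ltW/minc => //; rewrite in_itv /= ?lexx ?bc // t2 ltW.
  + by have := lt_trans (le_lt_trans bs st) tb; rewrite ltxx.
  + by apply: minc => //; rewrite in_itv /= ?bs ?bt.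
- move=> u; rewrite /= in_itv /= => /andP[u1 u2].
  have [ub|bu] := ltP u b'.
    have [|t tab tu] := ls u; first by rewrite /= in_itv /= u1 ltW.
    move: tab; rewrite /= in_itv /= => /andP[t1 t2].
    have tb : t < b.
      by rewrite lt_neqAle t2 andbT; apply: contraTneq ub => tb; rewrite -tu tb lb ltxx.
    by exists t; rewrite /= ?tb // in_itv /= t1 (le_trans t2).
  have [|t tab tu] := ms u; first by rewrite /= in_itv /= bu.
  move: tab; rewrite /= in_itv /= => /andP[t1 t2].
  by exists t; rewrite /= ?ltNge ?t1 //= in_itv /= t2 (le_trans ab).
- split; last by rewrite ltNge bc.
  (* If [a = b], the branch of [l] is empty and the left end is sent to [m b = b' = l a = a']. *)
  move: (ab); rewrite le_eqVlt => /orP[/eqP abE|->//].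
  by rewrite -{1}abE ltxx abE mb -lb -abE.
- move=> t /andP[t1 t2]; case: ltP => tb; first by rewrite lt // t1 ltW.
  by rewrite mt // tb.
- move=> t /andP[t1 t2]; case: ltP => tb; first by rewrite lv // t1 tb.
  by rewrite mv // tb.
Qed.

(** For the affine bijection, [t - l t] is a convex combination of [a - a'] and [b - b'], hence
    bounded by [d]. *)
Lemma matching_affine e d f g a b a' b' : a < b -> a' < b' ->
  `|a - a'| <= d -> `|b - b'| <= d ->
  (forall t t', a <= t < b -> a' <= t' < b' -> `|f t - g t'| <= e) ->
  matching e d f g a b a' b'.
Proof.
move=> ab ab' aa' bb' fg.
have D0 : 0 < b - a by rewrite subr_gt0.
have D0' : 0 < b' - a' by rewrite subr_gt0.
pose th t := (t - a) / (b - a); pose l t := a' + th t * (b' - a').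
have thE t : t = a + th t * (b - a) by rewrite /th divfK ?gt_eqF // addrC subrK.
have l_lt s t : s < t -> l s < l t.
  by move=> st; rewrite /l ltrD2l ltr_pM2r // ltr_pM2r ?invr_gt0 // ltrD2r.
have la : l a = a' by rewrite /l /th subrr !mul0r addr0.
have lb : l b = b' by rewrite /l /th divff ?gt_eqF // mul1r addrC subrK.
have th01 t : a <= t <= b -> 0 <= th t <= 1.
  move=> /andP[t1 t2]; rewrite /th divr_ge0 ?subr_ge0 ?(ltW ab) //=.
  by rewrite ler_pdivrMr // mul1r lerD2r.
exists l; split => //.
- by move=> s t _ _; exact: l_lt.
- move=> u /=; rewrite in_itv /= => /andP[u1 u2].
  exists (a + (u - a') / (b' - a') * (b - a)); last first.
    rewrite /l /th [a + _]addrC addrK mulfK ?gt_eqF // divfK ?gt_eqF //.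
    by rewrite addrC subrK.
  have h1 : 0 <= (u - a') / (b' - a') by rewrite divr_ge0 ?subr_ge0 // ltW.
  have h2 : (u - a') / (b' - a') <= 1 by rewrite ler_pdivrMr // mul1r lerD2r.
  by rewrite /= in_itv /=; nra.
- move=> t /th01 /andP[h1 h2]; rewrite {1}(thE t) /l.
  move: aa' bb'; rewrite !ler_norml => /andP[p1 p2] /andP[q1 q2].
  by apply/andP; split; nra.
- move=> t /andP[t1 t2]; apply: fg; first by rewrite t1.
  rewrite -[X in _ < X]lb l_lt // andbT -[leLHS]la.
  by move: t1; rewrite le_eqVlt => /orP[/eqP <- //|/l_lt/ltW].
Qed.

(* A code lists, for each piece of a partition of [a, b[, rational
   approximations of its right end, up to [d], and of [f] on it, up to [e]. *)
Fixpoint coded e d f a b (c : seq (rat * rat)) : Prop :=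
  if c is (q, v) :: c' then exists m, [/\ a < m <= b, `|m - ratr q| <= d,
      forall t, a <= t < m -> `|f t - ratr v| <= e & coded e d f m b c']
  else a = b.

Lemma coded_le e d f a b c : coded e d f a b c -> a <= b.
Proof. by case: c => [->//|[q v] c [m [/andP[am mb]]]] _ _ _; rewrite ltW ?(lt_le_trans am). Qed.

(** Corresponding breakpoints lie within [d] of the same rational and corresponding values within
    [e] of another, whence the factors 2. The affine matchings of the pieces are glued along the
    code. *)
Lemma coded_matching e d f g a b a' b' c :
  coded e d f a b c -> coded e d g a' b' c -> `|a - a'| <= d *+ 2 ->
  matching (e *+ 2) (d *+ 2) f g a b a' b'.
Proof.
elim: c a a' => [|[q v] c IH] a a' /=; first by move=> <- <-; exact: matching_point.
move=> [m [/andP[am mb] mq fv cm]] [m' [/andP[am' mb'] mq' gv cm']] aa'.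
have mm' : `|m - m'| <= d *+ 2.
  by apply: le_trans (ler_distD (ratr q) _ _) _; rewrite mulr2n lerD // distrC.
apply: (matching_glue (b := m) (b' := m')) mb _ (IH _ _ cm cm' mm'); first exact: ltW.
apply: matching_affine => // t t' /fv ft /gv gt.
by apply: le_trans (ler_distD (ratr v) _ _) _; rewrite mulr2n lerD // distrC.
Qed.

Lemma coded_bounded e d f a b c : coded e d f a b c ->
  exists B : nat, forall t, a <= t < b -> `|f t| <= B%:R.
Proof.
elim: c a => [|[q v] c IH] a /=.
  by move=> ->; exists 0%N => t /andP[h /(le_lt_trans h)]; rewrite ltxx.
move=> [m [/andP[am mb] _ fv /IH [B fB]]].
exists (B + (Num.truncn (`|ratr v| + e)).+1)%N => t /andP[t1 t2].
rewrite natrD; have [tm|mt] := ltP t m; last first.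
  by rewrite (le_trans (fB t _)) ?mt // lerDl.
have : `|f t| <= `|f t - ratr v| + `|ratr v| by rewrite -[in leLHS](subrK (ratr v) (f t)) ler_normD.
have := fv t; rewrite t1 tm => /(_ isT).
have := truncnS_gt (`|ratr v| + e : R).
have : 0 <= B%:R :> R by [].
by lra.
Qed.

Lemma coded_cat e d f a b b' c c' :
  coded e d f a b c -> coded e d f b b' c' -> coded e d f a b' (c ++ c').
Proof.
move=> + cc'; have bb' := coded_le cc'.
elim: c a => [|[q v] c IH] a /=; first by move=> ->.
move=> [m [/andP[am mb] mq fv /IH cm]]; exists m; split => //.
by rewrite am (le_trans mb).
Qed.

(** The hypothesis uses half of [e]; the other half pays for rounding [y] to a rational. *)
Lemma coded_piece e d f a b y : 0 < e -> 0 < d -> a < b ->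
  (forall t, a <= t < b -> `|f t - y| <= e / 2) -> exists c, coded e d f a b c.
Proof.
move=> e0 d0 ab fy.
have [q] : exists q : rat, ratr q \in `]b - d, b[ by apply: rat_in_itvoo; lra.
rewrite in_itv /= => /andP[q1 q2].
have [v] : exists v : rat, ratr v \in `]y - e / 2, y[ by apply: rat_in_itvoo; lra.
rewrite in_itv /= => /andP[v1 v2].
exists [:: (q, v)] => /=; exists b; split => //; rewrite ?ab ?lexx //.
  by rewrite ler_norml; apply/andP; split; lra.
move=> t /fy; rewrite !ler_norml => /andP[h1 h2]; apply/andP; split; lra.
Qed.

(** Let [s] be the supremum of the points up to which a code exists. The left limit at [s] shows
    that [s] is reached, and right continuity would carry a code beyond [s] if [s < b]. *)
Lemma cadlag_coded e d f a b : 0 < e -> 0 < d -> a <= b ->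
  cadlag `[a, b] f -> exists c, coded e d f a b c.
Proof.
move=> e0 d0 ab cf; have e2 : 0 < e / 2 by rewrite divr_gt0.
pose S := [set s | a <= s <= b /\ exists c, coded e d f a s c].
have Sa : S a by split; [rewrite lexx|exists [::]].
have Sub : ubound S b by move=> s [/andP[]].
have Ssup : has_sup S by split; [exists a|exists b].
pose s := sup S.
have as_ : a <= s by apply: ub_le_sup => //; exists b.
have sb : s <= b by apply: ge_sup => //; exists a.
have sab : [set` `[a, b]] s by rewrite /= in_itv /= as_.
have [/cvgrPdist_le /(_ _ e2) fr [y /cvgrPdist_le /(_ _ e2) fl]] := cf s sab.
move: fr fl; rewrite !near_withinE => /nbhs_ballP [r /= r0 fr] /nbhs_ballP [r' /= r'0 fl].
have Ss : exists c, coded e d f a s c.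
  have [u [/andP[au ub] [c uc]] us] := sup_adherent r'0 Ssup.
  have us' : u <= s by apply: ub_le_sup; [exists b|split; [rewrite au|exists c]].
  move: us'; rewrite le_eqVlt => /orP[/eqP <-|us']; first by exists c.
  (* On [[u, s[] the function stays within [e / 2] of its left limit [y] at [s]. *)
  have [c' cc'] : exists c', coded e d f u s c'.
    apply: (@coded_piece _ _ _ _ _ y) => // t /andP[ut ts]; rewrite distrC; apply: fl => //.
      by rewrite /ball /= gtr0_norm ?subr_gt0 //; move: us; rewrite -/s; lra.
    by rewrite /= in_itv /= (le_trans au) // (le_trans (ltW ts)).
  by exists (c ++ c'); exact: coded_cat uc cc'.
move: sb; rewrite le_eqVlt => /orP[/eqP <- //|sb].
pose u := Num.min b (s + r / 2).
have su : s < u by rewrite lt_min sb; lra.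
have ub : u <= b by rewrite ge_min lexx.
have ur : u <= s + r / 2 by rewrite ge_min lexx orbT.
have [c' cc'] : exists c', coded e d f s u c'.
  apply: (@coded_piece _ _ _ _ _ (f s)) => // t /andP[st tu]; rewrite distrC.
  move: st; rewrite le_eqVlt => /orP[/eqP <-|st]; first by rewrite subrr normr0 ltW.
  apply: fr => //; first by rewrite /ball /= distrC gtr0_norm ?subr_gt0 //; lra.
  by rewrite /= in_itv /=; lra.
have [c cs] := Ss.
suff us : u <= s by have := lt_le_trans su us; rewrite ltxx.
apply: ub_le_sup; first by exists b.
split; first by rewrite ub andbT (le_trans as_) // ltW.
by exists (c ++ c'); exact: coded_cat cs cc'.
Qed.

End Matching.

(** * Separability of the Skorokhod space *)

Section SkorokhodSeparable.
Variable R : realType.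
Implicit Types (f g : skorokhod R) (e d : R).

(** The cutoff factor [w] is 1-Lipschitz with values in [[0, 1]]; the time shift in it is multiplied
    by [f t], which brings in the bound [B]. *)
Lemma psi_val_dist (T B : R) f g (t u : R) :
  0 <= t <= T -> 0 <= u <= T -> `|f t| <= B ->
  `|psi_val T f t - psi_val T g u| <= B * `|t - u| + `|f t - g u|.
Proof.
move=> /andP[t0 tT] /andP[u0 uT] fB.
pose w s := if s <= T - 1 then 1 else T - s.
have psiE h s : s <= T -> psi_val T h s = h s * w s.
  by move=> sT; rewrite /psi_val /w sT; case: ifP; rewrite ?mulr1.
have w01 s : s <= T -> 0 <= w s <= 1.
  by move=> sT; rewrite /w; case: (leP s) => ?; lra.
have wtu : `|w t - w u| <= `|t - u|.
  rewrite ler_norml /w; have := ler_norm (t - u); have := ler_norm (u - t).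
  by rewrite [`|u - t|]distrC => h1 h2; apply/andP; split;
    case: (leP t) => ?; case: (leP u) => ?; lra.
rewrite !psiE // (_ : _ - _ = f t * (w t - w u) + (f t - g u) * w u); last by ring.
apply: le_trans (ler_normD _ _) _; rewrite !normrM lerD ?ler_pM //.
have /andP[w0 w1] := w01 u uT.
by rewrite (ger0_norm w0) ler_piMr.
Qed.

Lemma skorokhod_dist_psi_le e d (B : R) (M : nat) f g : 0 <= e -> 0 <= d -> 0 <= B ->
  (forall t, 0 <= t < M%:R -> `|f t| <= B) ->
  matching e d f g 0 M%:R 0 M%:R ->
  (skorokhod_dist (psi M%:R f) (psi M%:R g) <= (d + B * d + e)%:E)%E.
Proof.
move=> e0 d0 B0 fB [l [linc ls [l0 lM] lt lv]].
have lmono := le_mono_in linc.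
have M0 : 0 <= M%:R :> R by [].
have I0 : 0 \in `[0, (M%:R : R)] by rewrite in_itv /= lexx.
have IM : M%:R \in `[0, (M%:R : R)] by rewrite in_itv /= lexx M0.
have lI : {homo l : t / t \in `[0, (M%:R : R)]}.
  move=> t tM; move: (tM); rewrite !in_itv /= => /andP[t0 tM'].
  by rewrite -{1}l0 -{1}lM !lmono // t0.
apply: le_trans (ereal_inf_lbound _) _.
  exists l => //; split => //; apply: segment_inc_surj_continuous => //.
  by rewrite l0 lM.
have Bd : 0 <= B * d by rewrite mulr_ge0.
rewrite ge_max; apply/andP; split; apply: ge_ereal_sup => _ [t tM <-]; rewrite lee_fin.
  apply: le_trans (lt t _) _; first by move: tM; rewrite /= in_itv.
  by lra.
move: (tM) (lI _ tM); rewrite /= !in_itv /= => tM' lM'.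
(* The matching says nothing about values at [M], but both cut-off functions vanish there. *)
have [tltM|Mt] := ltP t M%:R; last first.
  have -> : t = M%:R by apply/eqP; rewrite eq_le Mt andbT; case/andP: tM'.
  rewrite lM /psi_val; have -> : ((M%:R : R) <= M%:R - 1) = false by apply/negbTE; rewrite -ltNge; lra.
  by rewrite lexx subrr !mulr0 subrr normr0; lra.
have tt : 0 <= t < M%:R by case/andP: tM' => ->.
apply: le_trans (psi_val_dist _ tM' lM' (fB _ tt)) _.
have := lv _ tt; have := ler_wpM2l B0 (lt _ tM'); lra.
Qed.

(** The terms up to [N] contribute at most [e], since the weights sum to 1; the minimum with 1
    bounds the others by the geometric tail [2 ^- N]. *)
Lemma skorokhod_mdist_le e (N : nat) f g : 0 <= e ->
  (forall M : nat, (M <= N)%N -> (skorokhod_dist (psi M%:R f) (psi M%:R g) <= e%:E)%E) ->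
  skorokhod_mdist f g <= e + 2 ^- N.
Proof.
move=> e0 fg; rewrite -lee_fin skorokhod_mdistE.
have tail n : (\sum_(n.+1 <= M <oo) (2 ^- M : R)%:E)%E = (2 ^- n : R)%:E.
  rewrite -(@nneseries_addn _ (fun M => (2 ^- M : R)%:E)); last first.
    by move=> M; rewrite lee_fin invr_ge0 exprn_ge0.
  have := @cvg_geometric_eseries_half R 1%R n; rewrite mul1r.
  move=> /cvg_lim <- //; apply: eq_eseriesr => i _.
  by rewrite natrX div1r.
have p0 M : (0 <= (2 ^- M : R)%:E)%E by rewrite lee_fin invr_ge0 exprn_ge0.
pose u M : \bar R := ((2 ^- M)%:E * e%:E)%E.
pose v M : \bar R := if (N < M)%N then (2 ^- M)%:E else 0%E.
have u0 M : (0 <= u M)%E by rewrite mule_ge0.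
have v0 M : (0 <= v M)%E by rewrite /v; case: ifP.
apply: (@le_trans _ _ (\sum_(1 <= M <oo) (u M + v M))%E).
  apply: lee_nneseries => [M _ _|M _].
    by rewrite mule_ge0 // le_min lee01 skorokhod_dist_ge0.
  rewrite /u /v; have [NM|MN] := ltnP N M.
    rewrite -[leLHS]add0e leeD ?mule_ge0 //.
    by rewrite -[leRHS]mule1 lee_wpmul2l // ge_min lexx.
  by rewrite adde0 lee_wpmul2l // ge_min fg // orbT.
rewrite nneseriesD // EFinD leeD //.
  rewrite /u; under eq_eseriesr do rewrite muleC.
  rewrite nneseriesZl // tail expr0 invr1 mule1 //.
rewrite (nneseries_split _ N) // big_nat_cond big1 ?add0e; last first.
  by move=> i /andP[/andP[_ iN] _]; rewrite /v ltnNge -ltnS -add1n iN.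
rewrite add1n -tail; apply: lee_nneseries => [//|M _].
by rewrite /v; case: ifP.
Qed.

Lemma skorokhod_countable_code e : 0 < e ->
  exists F : skorokhod R -> nat, forall f g, F f = F g -> skorokhod_mdist f g <= e.
Proof.
move=> e0; have [N Ne] : exists N, 2 ^- N <= e / 2.
  have /ltW Ne := upper_nthrootP (leqnn (Num.bound (e / 2)^-1)).
  exists (Num.bound (e / 2)^-1); rewrite -lef_pV2 ?invrK ?posrE ?invr_gt0 ?exprn_gt0 ?divr_gt0 //.
pose code d (f : skorokhod R) (k : nat) : seq (rat * rat) :=
  xget [::] [set c | coded (e / 16) d f k%:R k.+1%:R c].
have codeP d f k : 0 < d -> coded (e / 16) d f k%:R k.+1%:R (code d f k).
  move=> d0; rewrite /code; case: xgetP => [//|nc].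
  have [||||c cc] := @cadlag_coded R (e / 16) d f k%:R k.+1%:R; rewrite ?divr_gt0 ?ler_nat //.
    move=> t kt; have ht : [set` `[0, +oo[] t.
      by move: kt; rewrite /= !in_itv /= andbT => /andP[/(le_trans _) ->].
    have [fr [l fl]] := cadlag_valP f ht.
    have sub : `[k%:R, k.+1%:R] `<=` (`[0, +oo[ : set R).
      by move=> s; rewrite /= !in_itv /= andbT => /andP[/(le_trans _) ->].
    split; first by apply: cvg_trans fr; apply: cvg_app; exact: within_subset.
    by exists l; apply: cvg_trans fl; apply: cvg_app; exact: within_subset.
  by case: (nc c).
(* The bound comes from codes with time precision 1, because the final precision [d f] is chosen in
   terms of it. *)
have bnd (f : skorokhod R) : exists B : nat, forall t, 0 <= t < N%:R -> `|f t| <= B%:R.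
  elim: N {Ne} => [|n [B fB]]; first by exists 0%N => t /andP[h /(le_lt_trans h)]; rewrite ltxx.
  have [B' fB'] := coded_bounded (codeP 1 f n ltr01).
  exists (B + B')%N => t /andP[t0 tn]; rewrite natrD; have [h|h] := ltP t n%:R.
    by rewrite (le_trans (fB t _)) ?t0 // lerDl.
  by rewrite (le_trans (fB' t _)) ?h // lerDr.
have [B BP] := choice bnd.
pose d (f : skorokhod R) := e / 16 / (B f).+1%:R.
(* Recording [B f] forces functions with equal codes to share the precision [d f], so that their
   codes are comparable. *)
exists (fun f => pickle (B f, [seq code (d f) f k | k <- iota 0 N])) => f g.
move=> /(pcan_inj pickleK)[Bfg cfg].
have dfg : d f = d g by rewrite /d Bfg.
have d0 : 0 < d f by rewrite !divr_gt0.
have {}cfg k : (k < N)%N -> code (d f) f k = code (d f) g k.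
  move=> kN; move: cfg; rewrite -dfg => /(congr1 (fun s => nth [::] s k)).
  by rewrite !(nth_map 0%N) ?size_iota // nth_iota.
have mat M : (M <= N)%N ->
    matching ((e / 16) *+ 2) (d f *+ 2) f g 0 M%:R 0 M%:R.
  elim: M => [_|M IH MN]; first by apply: matching_point; rewrite subrr normr0 mulrn_wge0 // ltW.
  apply: (matching_glue (b := M%:R) (b' := M%:R)) => //; first by rewrite ler_nat.
    exact/IH/ltnW.
  apply: (coded_matching (codeP _ f M d0)); first by rewrite cfg //; exact: codeP.
  by rewrite subrr normr0 mulrn_wge0 // ltW.
apply: le_trans (@skorokhod_mdist_le (e / 2) N f g _ _) _; first by rewrite divr_ge0 // ltW.
  move=> M MN; apply: le_trans (skorokhod_dist_psi_le (B := (B f)%:R) _ _ _ _ (mat M MN)) _.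
  - by rewrite mulrn_wge0 // divr_ge0 // ltW.
  - by rewrite mulrn_wge0 // ltW.
  - by [].
  - by move=> t /andP[t0 tM]; apply: BP; rewrite t0 (lt_le_trans tM) // ler_nat.
  (* With [d f *+ 2] and [(e / 16) *+ 2] the total is [e / 8 + e / 8], below [e / 2]. *)
  have h : d f * (B f)%:R + d f = e / 16.
    by rewrite /d -[X in _ + X]mulr1 -mulrDr natr1 divfK // pnatr_eq0.
  rewrite lee_fin; move: h; nra.
by rewrite [leRHS]splitr lerD2l.
Qed.

Lemma skorokhod_separable : exists x : nat -> skorokhod R,
  forall f e, 0 < e -> exists k, skorokhod_mdist f (x k) < e.
Proof.
have /choice [F FP] : forall n : nat, exists F : skorokhod R -> nat,
    forall f g, F f = F g -> skorokhod_mdist f g <= n.+1%:R^-1.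
  by move=> n; apply: skorokhod_countable_code; rewrite invr_gt0.
have c0 : cadlag `[0, +oo[ (fun=> 0 : R).
  by move=> t _; split; [exact: cvg_cst|exists 0; exact: cvg_cst].
pose f0 : skorokhod R := CadlagFun c0 (fun _ _ => erefl).
(* One representative for each class of each partition; [f0] only fills the empty classes. *)
pose y (p : nat * nat) := xget f0 [set g | F p.1 g = p.2].
exists (fun k => if unpickle k is Some p then y p else f0) => f e e0.
have [n ne] : exists n : nat, n.+1%:R^-1 < e.
  exists (Num.truncn e^-1); rewrite -[ltRHS]invrK ltf_pV2 ?posrE ?invr_gt0 //.
  exact: truncnS_gt.
exists (pickle (n, F n f)); rewrite pickleK; apply: le_lt_trans ne.
apply: FP; rewrite /y; case: xgetP => [g _ /= ->//|/(_ f) []//].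
Qed.

End SkorokhodSeparable.

Local Open Scope complex_scope.

Theorem theoremC7 (R : realType) :
  input_EDAP R (skorokhod R) /\ input_EDAP R[i] (skorokhod R).
Proof.
have [x xP] := skorokhod_separable R.
split; first exact: (@separable_input_EDAP R R (skorokhod R) x xP).
exact: (@separable_input_EDAP R R[i] (skorokhod R) x xP).
Qed.
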